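(* Let $N\ge 2$, $\mu_\beta>0$, $T_c>0$, and consider strategies $C\subseteq\{0,1,\ldots,N-1\}$ with $0\in C$ for injecting copies of a data chunk through the cellular network, with average cellular load $D=D(C)$, all as defined in the context. In the optimal strategy (the one minimizing $D$), the data chunk is delivered through the cellular network to $d$ seed nodes at time $t=0$, and to the nodes that do not have the content by the deadline at time $t=T_c$, and never at any other time. That is, if $C$ minimizes $D$ over all strategies, then $C=\{0,1,\ldots,d-1\}$ for some $d\ge 1$.
   Context: A data chunk is to be delivered to $N$ nodes before a deadline $T_c$. The system is at level $i$ at time $t$ when exactly $i$ nodes hold the chunk. The level process starts at level $0$ at time $0$ and is a pure-birth chain. A strategy is a set $C=\{c_1,\ldots,c_d\}$, $c_1<\dots<c_d$, of levels at which a copy is injected: as soon as a level $i\in C$ is reached before $T_c$, one copy is sent through the cellular network to a node without the chunk, so that the transition from level $i$ to $i+1$ is instantaneous. Necessarily $c_1=0$. At levels $i\notin C$, $1\le i<N$, the transition from $i$ to $i+1$ (due to opportunistic contacts) occurs at rate $\lambda_i=i(N-i)\mu_\beta$, where $\mu_\beta$ is the mean pairwise contact rate; level $N$ is absorbing. At time $T_c$ the chunk is sent through the cellular network to all nodes that do not have it. Let $p_i(t)$ be the probability of being at level $i$ at time $t$ (so $p_i(t)=0$ for $i\in C$). The average load of the cellular network is $$D=\sum_{i=1}^{N}(d_i+d_i^* )\,p_i(T_c),$$ where $d_i$ is the number of deliveries through the cellular network that take place until level $i$ is reached, i.e. $d_i=|\{0,1,\ldots,i-1\}\cap C|$, and $d_i^*=N-i$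 is the number of copies delivered upon reaching the deadline at level $i$. *)

(* Defs.v *)
From HB Require Import structures.
From mathcomp Require Import all_boot all_order all_algebra.
From mathcomp Require Import all_classical all_reals all_analysis.
Set Implicit Arguments.
Unset Strict Implicit.
Unset Printing Implicit Defensive.
Import Order.TTheory GRing.Theory Num.Theory.
Local Open Scope classical_set_scope.
Local Open Scope ring_scope.

Definition strategy (N : nat) (C : {set 'I_N}) : bool :=
  [exists c in C, val c == 0%N].

Definition transition_rate (R : realType) (N : nat) (mu_beta : R) (i : nat) : R :=
  (i * (N - i))%:R * mu_beta.

Definition mutually_independent (R : realType) (d : measure_display)
    (T : measurableType d) (P : probability T R) (I : finType)
    (tau : I -> {RV P >-> R}) : Prop :=
  forall (J : {set I}) (B : I -> set R),
    (forall i, i \in J -> measurable (B i)) ->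
    P [set w | forall i, i \in J -> B i (tau i w)] =
    (\prod_(i in J) P (tau i @^-1` B i))%E.

(* [tau j] is the time spent at level [j]; level [N] is never left. *)
Definition reach_time (R : realType) (N : nat) (T : Type)
    (tau : 'I_N -> T -> R) (i : nat) (w : T) : R :=
  \sum_(j < N | (j < i)%N) tau j w.

Definition level_at (R : realType) (N : nat) (T : Type)
    (tau : 'I_N -> T -> R) (t : R) (w : T) : nat :=
  \max_(i < N.+1 | reach_time tau i w <= t) val i.

(* Jump-chain/holding-time description of the pure-birth chain.  A level of
   [C] is left instantaneously, so its holding time is 0; in particular the
   chain moves from level 0 to level 1 at time 0.  Since [0] is in [C] for
   every strategy, the rate 0 of level 0 is never used. *)
Definition level_process (R : realType) (N : nat) (mu_beta : R)
    (C : {set 'I_N}) (d : measure_display) (T : measurableType d)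
    (P : probability T R) (X : R -> T -> nat) : Prop :=
  exists tau : 'I_N -> {RV P >-> R},
    [/\ mutually_independent tau,
        forall c, c \in C -> forall w, tau c w = 0,
        forall i, i \notin C -> forall A : set R, measurable A ->
          distribution P (tau i) A
          = exponential_prob (transition_rate N mu_beta i) A
      & forall t w, 0 <= t -> X t w = level_at tau t w].

Definition level_prob (R : realType) (d : measure_display)
    (T : measurableType d) (P : probability T R) (X : R -> T -> nat)
    (i : nat) (t : R) : R :=
  fine (P [set w | X t w = i]).

Definition deliveries_until (N : nat) (C : {set 'I_N}) (i : nat) : nat :=
  #|[set c in C | (c < i)%N]|.

Definition deadline_deliveries (N i : nat) : nat := (N - i)%N.

Definition average_load (R : realType) (N : nat) (C : {set 'I_N})
    (d : measure_display) (T : measurableType d) (P : probability T R)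
    (X : R -> T -> nat) (Tc : R) : R :=
  \sum_(1 <= i < N.+1)
    (deliveries_until C i + deadline_deliveries N i)%:R * level_prob P X i Tc.

(* Main.v *)
(** Counting deliveries level by level, D = N - E, where E is the expected
    number of opportunistic transitions completed by the deadline; and E is the
    sum over k of the probability that the first k holding times, independent
    exponentials whose rates are those of the levels outside C, add up to at
    most Tc.  Pointwise larger rates increase every term of E.

    Let C be optimal, and suppose that some level a is outside C while a + 1 is
    in C.  If the rate of a + 1 exceeds that of a, then exchanging the two levels
    strictly increases E.  Otherwise, the rates being i (N - i) mu_beta, they
    decrease from a on.  Removing a + 1 from C then inserts its rate in the list
    in front of a decreasing tail that it dominates: every rate of the old list
    is at most the rate at the same position in the new one, which moreover has
    one more term, so E strictly increases again.  Hence the complement of C is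
    closed upwards. *)
Require Import Defs.
From HB Require Import structures.
From mathcomp Require Import all_boot all_order all_algebra.
From mathcomp Require Import all_classical all_reals all_analysis.
From mathcomp Require Import measurable_realfun zify ring.
Import Order.TTheory GRing.Theory Num.Theory.
Local Open Scope classical_set_scope.
Local Open Scope ring_scope.

(** * Exponential laws and their distribution functions *)

(* [exponential_prob] is a measure on [measurableTypeR R], whose display differs
   from that of [R]; this identity transports it. *)
Definition real_of_borel {R : realType} : measurableTypeR R -> R := idfun.

HB.instance Definition _ {R : realType} :=
  @isMeasurableFun.Build _ _ _ _ (@real_of_borel R) (@measurable_id _ _ _).

(* The Dirac mass at 0 is a junk value for rates that are not positive. *)
Definition exponential_law {R : realType} (r : R) : probability R R :=
  match pselect (0 < r) with
  | left r0 =>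
      distribution
        (ltac:(refine [the probability _ _ of exponential_prob r]; exact r0)
          : probability (measurableTypeR R) R)
        (@real_of_borel R)
  | right _ => \d_(0 : R)
  end.

Lemma exponential_lawE {R : realType} (r : R) : 0 < r ->
  exponential_law r = exponential_prob r :> (set R -> \bar R).
Proof. by move=> r0; rewrite /exponential_law; case: pselect => //. Qed.

Lemma exponential_law_cdf {R : realType} (r u : R) : 0 < r ->
  exponential_law r `]-oo, u]%classic = (1 - expR (- r * Num.max u 0))%:E.
Proof.
move=> r0; rewrite exponential_lawE//.
have mpdf A : measurable_fun A (fun x : R => (exponential_pdf r x)%:E).
  by apply/measurable_EFinP; apply: measurable_funTS;
    exact: measurable_exponential_pdf.
have neg : exponential_prob r `]-oo, 0] = 0%E.
  rewrite /exponential_prob -integral_itv_bndo_bndc//.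
  by apply: integral0_eq => x /=; rewrite in_itv/= => /lt0_exponential_pdf ->.
have [u0|u0] := leP u 0.
  rewrite mulr0 expR0 subrr; apply/eqP;
    rewrite eq_le -[X in (_ <= X)%E]neg -{1}exponential_lawE //.
  apply/andP; split; last by rewrite -exponential_lawE// measure_ge0.
  rewrite -exponential_lawE//; apply: le_measure; rewrite ?inE//.
  by move=> x /=; rewrite !in_itv/= => /le_trans; apply.
(* For [u > 0] the half-line lies between [[0, u]] and []-oo, 0] ∪ [0, u]], which have the same mass
   because the density vanishes on the negative reals. *)
rewrite EFinB -exponential_prob_itv0c// -!exponential_lawE//.
apply/eqP; rewrite eq_le; apply/andP; split; last first.
  by apply: le_measure; rewrite ?inE// => x /=; rewrite !in_itv/= => /andP[].
apply: (@le_trans _ _ (exponential_law r (`]-oo, 0] `|` `[0, u]))).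
  apply: le_measure; rewrite ?inE//; first exact: measurableU.
  move=> x /=; rewrite !in_itv/= => ->; rewrite andbT.
  by case: (leP x 0) => [|/ltW]; [left|right].
apply: (le_trans (measureU2 _ _ _)) => //; rewrite -[leRHS]add0e.
by apply: leeD => //; rewrite -neg -exponential_lawE.
Qed.

(** * Convolution and comparison of distribution functions *)

Definition add_pair {R : realType} (p : R * R) : R := p.1 + p.2.

Lemma measurable_add_pair {R : realType} :
  measurable_fun [set: R * R] (@add_pair R).
Proof.
by apply: measurable_funD; [exact: measurable_fst|exact: measurable_snd].
Qed.

HB.instance Definition _ {R : realType} :=
  @isMeasurableFun.Build _ _ (R * R)%type R
    (@add_pair R) (@measurable_add_pair R).

Definition conv {R : realType} (m1 m2 : probability R R) : probability R R :=
  distribution (m1 \x m2)%E (@add_pair R).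

(** This is the usual stochastic order reversed: the larger law is that of the smaller, hence
    faster, random time. *)
Definition cdf_le {R : realType} (m1 m2 : probability R R) :=
  forall u, (m1 `]-oo, u]%classic <= m2 `]-oo, u]%classic)%E.

Lemma measurable_add_le {R : realType} (t : R) :
  measurable (@add_pair R @^-1` `]-oo, t]%classic).
Proof. by rewrite -[X in measurable X]setTI; exact: measurable_add_pair. Qed.

Lemma conv_cdf1 {R : realType} (m1 m2 : probability R R) t :
  conv m1 m2 `]-oo, t]%classic = (\int[m1]_x m2 `]-oo, (t - x)%R]%classic)%E.
Proof.
apply: eq_integral => x _ /=; congr (m2 _).
by apply/seteqP; split => y;
  rewrite xsectionE /= !in_itv /= /add_pair /= lerBrDl.
Qed.

(** Fubini: both iterated product measures agree on rectangles, hence everywhere. *)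
Lemma conv_cdf2 {R : realType} (m1 m2 : probability R R) t :
  conv m1 m2 `]-oo, t]%classic = (\int[m2]_x m1 `]-oo, (t - x)%R]%classic)%E.
Proof.
rewrite /conv /distribution /pushforward /=.
rewrite (@product_measure_unique _ _ _ _ _ m1 m2 (m1 \x^ m2)%E);
  last exact: measurable_add_le.
  apply: eq_integral => x _ /=; congr (m1 _).
  by apply/seteqP; split => y;
    rewrite ysectionE /= !in_itv /= /add_pair /= lerBrDr.
by move=> A B mA mB; rewrite -product_measure2E.
Qed.

Lemma measurable_cdf_sub {R : realType} (m : probability R R) t :
  measurable_fun [set: R] (fun x => m `]-oo, (t - x)%R]%classic).
Proof.
have -> : (fun x => m `]-oo, (t - x)%R]%classic) =
  m \o xsection (@add_pair R @^-1` `]-oo, t]%classic).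
  apply/funext => x /=; congr (m _).
  by apply/seteqP; split => y;
    rewrite xsectionE /= !in_itv /= /add_pair /= lerBrDl.
by apply: measurable_fun_xsection; exact: measurable_add_le.
Qed.

(** One factor is changed at a time, integrating against the factor that stays fixed; this is why
    both disintegrations of [conv] are needed. *)
Lemma cdf_le_conv {R : realType} (m1 m2 m1' m2' : probability R R) :
  cdf_le m1 m1' -> cdf_le m2 m2' -> cdf_le (conv m1 m2) (conv m1' m2').
Proof.
move=> le1 le2 t; apply: (@le_trans _ _ (conv m1 m2' `]-oo, t]%classic)).
  by rewrite !conv_cdf1; apply: ge0_le_integral => //;
    exact: measurable_cdf_sub.
by rewrite !conv_cdf2; apply: ge0_le_integral => //; exact: measurable_cdf_sub.
Qed.

(** This keeps a strict inequality between distribution functions strict after convolution, and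
    makes distribution functions positive at every positive time. *)
Definition charges_near0 {R : realType} (m : probability R R) :=
  forall e : R, 0 < e -> (0 < m `[0%R, e]%classic)%E.

Lemma charges_near0_conv {R : realType} (m1 m2 : probability R R) :
  charges_near0 m1 -> charges_near0 m2 -> charges_near0 (conv m1 m2).
Proof.
move=> n1 n2 e e0; have e20 : 0 < e / 2 by rewrite divr_gt0.
apply: (@lt_le_trans _ _
  ((m1 \x m2)%E (`[0, e / 2]%classic `*` `[0, e / 2]%classic))).
  by rewrite /= product_measure1E// mule_gt0 ?n1 ?n2.
apply: le_measure; rewrite ?inE.
- exact: measurableX.
- by rewrite -[X in measurable X]setTI; exact: measurable_add_pair.
- move=> [x y]; rewrite /= /add_pair /= !in_itv /= =>
    -[/andP[x0 xe] /andP[y0 ye]].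
  by rewrite addr_ge0//= (splitr e) lerD.
Qed.

(* The integrands [m1 ]-oo, t - x]] and [m2 ]-oo, t - x]] differ for all
   [x < t], in particular on [[0, t / 2]], which [m] charges. *)
Lemma conv_cdf_lt {R : realType} (m m1 m2 : probability R R) (t : R) :
  0 < t -> charges_near0 m -> cdf_le m1 m2 ->
  (forall u, 0 < u -> (m1 `]-oo, u]%classic < m2 `]-oo, u]%classic)%E) ->
  (conv m m1 `]-oo, t]%classic < conv m m2 `]-oo, t]%classic)%E.
Proof.
move=> t0 m0 le12 lt12; rewrite lt_neqAle cdf_le_conv// andbT.
apply/eqP; rewrite !conv_cdf1 => eq12.
pose f i (x : R) := (if i then m2 else m1) `]-oo, (t - x)%R]%classic.
have mf i : measurable_fun [set: R] (f i) by exact: measurable_cdf_sub.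
have fin i x : f i x \is a fin_num by rewrite /f fin_num_measure.
pose g x := (f true x - f false x)%E.
have mg : measurable_fun [set: R] g by exact: emeasurable_funB.
have g0 x : (0 <= g x)%E by rewrite sube_ge0 ?fin//; exact: le12.
have intg : (\int[m]_x `|g x| = 0)%E.
  under eq_integral do rewrite gee0_abs//.
  have : (\int[m]_x f true x = \int[m]_x f false x + \int[m]_x g x)%E.
    rewrite -ge0_integralD//.
    by apply: eq_integral => x _; rewrite /g addeC subeK ?fin.
  rewrite /f /= -eq12 -conv_cdf1 => e.
  rewrite -[LHS](@addeK _ (conv m m1 `]-oo, t]%classic)) ?fin_num_measure//.
  by rewrite [X in (X - _)%E]addeC -e subee// fin_num_measure.
(* The nonnegative [g] has integral 0, so it vanishes off a null set [A]. Since [g] is positive on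
   [[0, t / 2]], that interval lies in [A], although [m] charges it. *)
have [A [mA A0 sA]] := (ae_eq_integral_abs m measurableT mg).1 intg.
have t20 : 0 < t / 2 by rewrite divr_gt0.
have := m0 _ t20; rewrite ltNge => /negP; apply.
rewrite -A0; apply: le_measure; rewrite ?inE// => x;
  rewrite /= in_itv /= => /andP[_ xt].
apply: sA => /= /(_ I) /eqP; rewrite sube_eq ?fin ?fin_num_adde_defr// add0e.
apply/negP; rewrite gt_eqF//; apply: lt12.
by rewrite subr_gt0 (le_lt_trans xt)// ltr_pdivrMr// mulr2n mulrDr mulr1 ltrDl.
Qed.

(** * Monotonicity of exponential and hypoexponential laws in their rates *)

Lemma cdf_le_refl {R : realType} (m : probability R R) : cdf_le m m.
Proof. by move=> u. Qed.

Lemma charges_near0_exponential_law {R : realType} (r : R) :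
  0 < r -> charges_near0 (exponential_law r).
Proof.
move=> r0 e e0; rewrite exponential_lawE// exponential_prob_itv0c// -EFinB
  lte_fin subr_gt0.
by rewrite -expR0 ltr_expR mulNr oppr_lt0 mulr_gt0.
Qed.

Lemma exponential_law_cdf_le {R : realType} (r r' : R) :
  0 < r -> r <= r' -> cdf_le (exponential_law r) (exponential_law r').
Proof.
move=> r0 rr' u; rewrite !exponential_law_cdf ?(lt_le_trans r0)// lee_fin
  lerB// ler_expR.
by rewrite !mulNr lerN2 ler_wpM2r// le_max lexx orbT.
Qed.

Lemma exponential_law_cdf_lt {R : realType} (r r' u : R) :
  0 < r -> r < r' -> 0 < u ->
  (exponential_law r `]-oo, u]%classic <
    exponential_law r' `]-oo, u]%classic)%E.
Proof.
move=> r0 rr' u0; have r'0 := lt_trans r0 rr'.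
rewrite !exponential_law_cdf// (max_l (ltW u0)) lte_fin.
by rewrite ltrD2l ltrN2 ltr_expR !mulNr ltrN2 ltr_pM2r.
Qed.

(** Law of a sum of independent exponential times with rates [s]. The left fold makes appending a
    rate a single convolution, as when the chain passes one more level. *)
Definition hypoexp_law {R : realType} (s : seq R) : probability R R :=
  foldl (fun m r => conv m (exponential_law r)) (\d_(0 : R)) s.

Lemma hypoexp_law_rcons {R : realType} (s : seq R) r :
  hypoexp_law (rcons s r) = conv (hypoexp_law s) (exponential_law r).
Proof. by rewrite /hypoexp_law foldl_rcons. Qed.

Lemma hypoexp_law_cdf_le {R : realType} (s s' : seq R) :
  all (> 0) s -> all2 <=%R s s' -> cdf_le (hypoexp_law s) (hypoexp_law s').
Proof.
(* The accumulator of the fold changes along the induction, so the starting measures are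
   generalized. *)
suff gen m m' : cdf_le m m' -> all (> 0) s -> all2 <=%R s s' ->
    cdf_le (foldl (fun m r => conv m (exponential_law r)) m s)
           (foldl (fun m r => conv m (exponential_law r)) m' s').
  by apply: gen; exact: cdf_le_refl.
elim: s s' m m' => [|r s IH] [|r' s'] m m' //= mm' /andP[r0 s0] /andP[rr' ss'].
by apply: IH => //; apply: cdf_le_conv => //; exact: exponential_law_cdf_le.
Qed.

Lemma charges_near0_hypoexp_law {R : realType} (s : seq R) : all (> 0) s ->
  charges_near0 (hypoexp_law s).
Proof.
elim/last_ind: s => [_ e e0|s r IH].
  by rewrite /hypoexp_law /= diracE mem_set ?lte_fin//= in_itv/= lexx ltW.
rewrite all_rcons hypoexp_law_rcons => /andP[r0 s0].
by apply: charges_near0_conv; [exact: IH|exact: charges_near0_exponential_law].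
Qed.

Definition hypoexp_cdf {R : realType} (t : R) (s : seq R) : R :=
  fine (hypoexp_law s `]-oo, t]%classic).

Lemma hypoexp_cdf_le {R : realType} (t : R) s s' : all (> 0) s ->
  all2 <=%R s s' ->
  hypoexp_cdf t s <= hypoexp_cdf t s'.
Proof.
move=> s0 ss'; apply: fine_le; rewrite ?fin_num_measure//.
exact: hypoexp_law_cdf_le.
Qed.

Lemma hypoexp_cdf_gt0 {R : realType} (t : R) s : 0 < t -> all (> 0) s ->
  0 < hypoexp_cdf t s.
Proof.
move=> t0 /charges_near0_hypoexp_law/(_ _ t0) h; apply: fine_gt0;
  rewrite -ge0_fin_numE// fin_num_measure// andbT.
apply: (lt_le_trans h); apply: le_measure; rewrite ?inE//.
by move=> x /=; rewrite !in_itv/= => /andP[].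
Qed.

Lemma hypoexp_cdf_rcons_lt {R : realType} (t : R) s r r' : 0 < t ->
  all (> 0) (rcons s r) -> r < r' ->
  hypoexp_cdf t (rcons s r) < hypoexp_cdf t (rcons s r').
Proof.
rewrite all_rcons => t0 /andP[r0 s0] rr'.
rewrite /hypoexp_cdf !hypoexp_law_rcons -lte_fin !fineK ?fin_num_measure//.
apply: conv_cdf_lt => //; first exact: charges_near0_hypoexp_law.
  by apply: exponential_law_cdf_le => //; exact: ltW.
by move=> u u0; exact: exponential_law_cdf_lt.
Qed.

(** * Mean number of transitions and its dependence on the list of rates *)

(* The expected number of partial sums that are at most [t]. *)
Definition mean_transitions {R : realType} (t : R) (s : seq R) : R :=
  \sum_(k < size s) hypoexp_cdf t (take k.+1 s).

Lemma mean_transitions_rcons {R : realType} (t : R) s r :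
  mean_transitions t (rcons s r) =
    mean_transitions t s + hypoexp_cdf t (rcons s r).
Proof.
rewrite /mean_transitions size_rcons big_ord_recr /= take_oversize
  ?size_rcons//.
congr (_ + _); apply: eq_bigr => k _; congr hypoexp_cdf.
by rewrite -cats1 takel_cat.
Qed.

Lemma all2_cat {T : Type} (e : rel T) s1 s2 s1' s2' : size s1 = size s1' ->
  all2 e (s1 ++ s2) (s1' ++ s2') = all2 e s1 s1' && all2 e s2 s2'.
Proof. by elim: s1 s1' => [|x s1 IH] [|y s1'] //= [/IH ->]; rewrite andbA. Qed.

Lemma all2_rconsl {T : Type} (e : rel T) s s' r : all2 e (rcons s r) s' ->
  exists u z, [/\ s' = rcons u z, all2 e s u & e r z].
Proof.
case/lastP: s' => [|u z]; first by case: s => //= a s; case: s.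
rewrite -!cats1 => h; exists u, z; have ss : size s = size u.
  move: h; rewrite all2E => /andP[/eqP + _]; rewrite !size_cat /= !addn1;
    by case.
by move: h; rewrite all2_cat//= andbT => /andP[su rz]; rewrite cats1.
Qed.

Lemma mean_transitions_le {R : realType} (t : R) s s' : all (> 0) s ->
  all2 <=%R s s' ->
  mean_transitions t s <= mean_transitions t s'.
Proof.
elim/last_ind: s s' => [|s r IH] s'; first by case: s'.
move=> s0 ss'; have [u [z [es' su rz]]] := all2_rconsl _ _ _ _ ss'.
rewrite es' !mean_transitions_rcons lerD ?IH//;
  last by rewrite -es' hypoexp_cdf_le.
by move: s0; rewrite all_rcons => /andP[].
Qed.

Lemma all2_le_refl {R : realType} (s : seq R) : all2 <=%R s s.
Proof. by elim: s => //= x s ->; rewrite lexx. Qed.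

(** The prefixes that stop before [x] are unchanged, the one that ends at [x] gains strictly, and
    the longer ones do not lose. *)
Lemma mean_transitions_replace {R : realType} (t : R) s1 x x' s2 : 0 < t ->
  all (> 0) (s1 ++ x :: s2) -> x < x' ->
  mean_transitions t (s1 ++ x :: s2) < mean_transitions t (s1 ++ x' :: s2).
Proof.
move=> t0 s0 xx'; elim/last_ind: s2 s0 => [|s2 r IH] s0.
  rewrite !cats1 !mean_transitions_rcons ler_ltD//.
  by apply: hypoexp_cdf_rcons_lt; rewrite -?cats1.
rewrite -!rcons_cons -!rcons_cat !mean_transitions_rcons.
apply: ltr_leD.
  by apply: IH; move: s0; rewrite -!rcons_cons -!rcons_cat all_rcons => /andP[].
rewrite !rcons_cat !rcons_cons; apply: hypoexp_cdf_le => //.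
by rewrite all2_cat// all2_le_refl /= ltW// all2_le_refl.
Qed.

(* The longer list dominates [s1 ++ x :: s2] position by position, and its last
   partial sum is an additional positive term. *)
Lemma mean_transitions_insert {R : realType} (t : R) s1 x y s2 : 0 < t ->
  all (> 0) (s1 ++ x :: y :: s2) -> path >=%R y s2 ->
  mean_transitions t (s1 ++ x :: s2) < mean_transitions t (s1 ++ x :: y :: s2).
Proof.
move=> t0 s0 ys2.
have pos : all (> 0) (s1 ++ x :: s2).
  by move: s0; rewrite !all_cat /= => /and4P[-> -> _ ->].
(* The last rate is split off. As [y :: s2] is nonincreasing, [belast y s2] dominates [s2] position
   by position. *)
rewrite (lastI y) -rcons_cons -rcons_cat mean_transitions_rcons.
apply: (@le_lt_trans _ _ (mean_transitions t (s1 ++ x :: belast y s2))).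
  apply: mean_transitions_le => //; rewrite all2_cat// all2_le_refl /= lexx /=.
  by elim: s2 y ys2 {s0 pos} => //= z s2 IH y /andP[-> /IH].
by rewrite ltrDl hypoexp_cdf_gt0// rcons_cat rcons_cons -lastI.
Qed.

(** * From independent holding times to the law of the level *)

(** The joint law of [S] and [Y] restricted to [E], rescaled by the inverse of [P E], agrees with
    the product measure on rectangles, hence everywhere. The event [E] carries the conditions on
    later levels. *)
Lemma add_independent {d} {T : measurableType d} {R : realType}
    (P : probability T R) (S Y : {mfun T >-> R}) (E : set T) (m1 m2 : probability R R) :
  measurable E ->
  (forall A B, measurable A -> measurable B ->
    P ((S @^-1` A `&` Y @^-1` B) `&` E) = (m1 A * m2 B * P E)%E) ->
  forall A, measurable A ->
    P ((fun w => S w + Y w) @^-1` A `&` E) = (conv m1 m2 A * P E)%E.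
Proof.
move=> mE SY A mA.
have mSY : measurable_fun [set: T] (fun w => (S w, Y w)).
  by apply/measurable_fun_pairP; split => //=; exact: measurable_funPT.
have mSYA : measurable ((fun w => S w + Y w) @^-1` A).
  by rewrite -[X in measurable X]setTI; apply: measurable_funD.
(* No rescaling is possible when [P E = 0], but then both sides are 0. *)
have [PE0|PE0] := eqVneq (P E) 0%E.
  rewrite PE0 mule0; apply/eqP; rewrite eq_le measure_ge0 andbT -PE0.
  by apply: le_measure; rewrite ?inE//; exact: measurableI.
have [c c0 PEc] : exists2 c : R, 0 < c & P E = c%:E.
  have PEf : P E \is a fin_num by rewrite fin_num_measure.
  exists (fine (P E)); last by rewrite fineK.
  by rewrite -lte_fin fineK// lt_neqAle eq_sym PE0 measure_ge0.
have ci0 : 0 <= c^-1 by rewrite invr_ge0 ltW.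
have @p : {measure set (R * R) -> \bar R}.
  refine [the {measure set _ -> \bar _} of
    pushforward (mrestr P mE) (fun w => (S w, Y w))].
  exact: mSY.
pose m' : {measure set (R * R) -> \bar R} :=
  [the {measure set _ -> \bar _} of mscale (NngNum ci0) p].
have m'E U : m' U = (c^-1%:E * P ((fun w => (S w, Y w)) @^-1` U `&` E))%E by [].
have -> : conv m1 m2 A = m' (@add_pair R @^-1` A).
  apply: product_measure_unique; last first.
    by rewrite -[X in measurable X]setTI; exact: measurable_add_pair.
  move=> B1 B2 mB1 mB2.
  rewrite m'E [X in P X](_ : _ = (S @^-1` B1 `&` Y @^-1` B2) `&` E)//.
  by rewrite SY// PEc muleC -muleA -EFinM divff ?gt_eqF// mule1.
by rewrite m'E muleAC PEc -EFinM mulVf ?gt_eqF// mul1e.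
Qed.

(* Levels are natural numbers here, so that [opportunistic C N] holds. *)
Definition opportunistic {N : nat} (C : {set 'I_N}) (j : nat) : bool :=
  j \notin [seq val c | c in C].

Lemma opportunisticE {N : nat} (C : {set 'I_N}) (i : 'I_N) :
  opportunistic C i = (i \notin C).
Proof. by rewrite /opportunistic mem_map ?mem_enum//; exact: val_inj. Qed.

Definition rates {R : realType} {N : nat} (mu : R) (C : {set 'I_N}) (n : nat) :
    seq R :=
  [seq transition_rate N mu j | j <- iota 0 n & opportunistic C j].

Lemma ratesS {R : realType} {N : nat} (mu : R) (C : {set 'I_N}) (n : nat) :
  rates mu C n.+1 =
    if opportunistic C n then rcons (rates mu C n) (transition_rate N mu n)
    else rates mu C n.
Proof.
rewrite /rates -addn1 iotaD filter_cat map_cat add0n /=.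
by case: ifP => _ /=; rewrite ?cats1 ?cats0.
Qed.

Lemma reach_timeS {R : realType} {N : nat} {T : Type}
    (tau : 'I_N -> T -> R) (i : 'I_N) w :
  reach_time tau i.+1 w = reach_time tau i w + tau i w.
Proof.
rewrite /reach_time (bigD1 i)//= addrC; congr (_ + _); apply: eq_bigl => j.
by rewrite ltnS leq_eqVlt -val_eqE /=; case: ltngtP.
Qed.

Lemma measurable_reach_time {d} {T : measurableType d} {R : realType} {N : nat}
    (tau : 'I_N -> {mfun T >-> R}) n :
  measurable_fun [set: T] (reach_time tau n).
Proof.
have -> : reach_time tau n =
    fun w => \sum_(j <- enum 'I_N) if (j < n)%N then tau j w else 0.
  by apply/funext => w; rewrite /reach_time big_enum [LHS]big_mkcond.
by apply: measurable_sum => j; case: (j < n)%N => //; exact: measurable_funPT.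
Qed.

Section reach.
Context {R : realType} {N : nat} (mu : R) (mu0 : 0 < mu)
  (C : {set 'I_N}) (hC : strategy C)
  {d : measure_display} {T : measurableType d} (P : probability T R)
  (tau : 'I_N -> {RV P >-> R}).
Hypotheses (indep : mutually_independent tau)
  (tau0 : forall c, c \in C -> forall w, tau c w = 0)
  (taue : forall i, i \notin C -> forall A : set R, measurable A ->
    distribution P (tau i) A = exponential_prob (transition_rate N mu i) A).

Lemma strategy_rate_gt0 (i : 'I_N) : i \notin C -> 0 < transition_rate N mu i.
Proof.
move=> iC; rewrite /transition_rate mulr_gt0// ltr0n muln_gt0 subn_gt0 ltn_ord
  andbT.
rewrite lt0n; apply: contraNneq iC => i0;
  have /existsP[c /andP[cC /eqP c0]] := hC.
by rewrite (_ : i = c)//; apply: val_inj; rewrite [LHS]i0 c0.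
Qed.

(* The event on the levels [J] beyond [n] is what makes the induction on [n] go
   through: mutual independence only speaks of the individual holding times. *)
Lemma reach_time_law n (J : {set 'I_N}) (B : 'I_N -> set R) (A : set R) :
  (n <= N)%N -> (forall i, i \in J -> (n <= i)%N) ->
  (forall i, i \in J -> measurable (B i)) -> measurable A ->
  P (reach_time tau n @^-1` A `&`
     [set w | forall i, i \in J -> B i (tau i w)]) =
  (hypoexp_law (rates mu C n) A *
    P [set w | forall i, i \in J -> B i (tau i w)])%E.
Proof.
elim: n J B A => [|n IH] J B A nN nJ mB mA.
  have -> : reach_time tau 0 = cst 0.
    by apply/funext => w; rewrite /reach_time big1.
  rewrite preimage_cst /hypoexp_law /= diracE; have [A0|A0] := pselect (A 0).
    by rewrite !mem_set// setTI mul1e.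
  by rewrite !memNset// set0I measure0 mul0e.
pose i := Ordinal nN.
have -> : reach_time tau n.+1 =
    (fun w => reach_time tau n w + tau i w).
  by apply/funext => w; rewrite -[n.+1]/((i : nat).+1) reach_timeS.
rewrite ratesS -[n in opportunistic C n]/(i : nat) opportunisticE;
  case: (boolP (i \in C)) => /= iC.
  rewrite [X in X @^-1` _](_ : _ = reach_time tau n).
    by apply: IH => // [|j /nJ/ltnW]; first exact: ltnW.
  by apply/funext => w; rewrite tau0// addr0.
have iJ : i \notin J by apply/negP => /nJ; rewrite ltnn.
have mS := measurable_reach_time tau n.
pose S : {mfun T >-> R} := mfun_Sub (mem_set mS).
have mJ : measurable [set w | forall i, i \in J -> B i (tau i w)].
  rewrite (_ : [set w | _] =
    \bigcap_(j in [set j | j \in J]) (tau j @^-1` B j)).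
    apply: fin_bigcap_measurable => // j jJ.
    by rewrite -[X in measurable X]setTI; apply: measurable_funPT => //;
      exact: mB.
  by apply/seteqP; split => w /=.
rewrite hypoexp_law_rcons;
  apply: (add_independent P S (tau i)) => // A' B' mA' mB'.
(* The condition on level [i] joins those on [J], so that the induction hypothesis applies to
   [i |: J]. *)
pose B2 j := if j == i then B' else B j.
have mB2 j : j \in i |: J -> measurable (B2 j).
  by rewrite in_setU1 /B2; case: eqP => //= _; exact: mB.
have eE : [set w | forall j, j \in i |: J -> B2 j (tau j w)] =
    tau i @^-1` B' `&` [set w | forall i, i \in J -> B i (tau i w)].
  apply/seteqP; split => w /= => [h|[hi h] j].
    split; first by have := h i; rewrite setU11 /B2 eqxx; apply.
    move=> j jJ; have := h j; rewrite in_setU1 jJ orbT /B2 => /(_ isT).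
    by case: eqP => // ji; rewrite -ji jJ in iJ.
  by rewrite in_setU1 /B2; case: eqP => [->|_]//=; exact: h.
rewrite -setIA -eE IH//; last 2 first.
- exact: ltnW.
- by move=> j; rewrite in_setU1 => /orP[/eqP ->//|/nJ/ltnW].
rewrite indep// big_setU1//= -muleA; congr (_ * (_ * _))%E.
  rewrite /B2 eqxx -[LHS]/(distribution P (tau i) B') taue// exponential_lawE//.
  exact: (strategy_rate_gt0 i).
rewrite indep//; apply: eq_bigr => j jJ; rewrite /B2; case: eqP => // ji.
by rewrite -ji jJ in iJ.
Qed.

Lemma reach_time_cdf n t : (n <= N)%N ->
  P [set w | reach_time tau n w <= t] =
    hypoexp_law (rates mu C n) `]-oo, t]%classic.
Proof.
move=> nN.
have e0 : [set w | forall i, i \in (finset.set0 : {set 'I_N}) ->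
  [set: R] (tau i w)] = setT.
  by apply/seteqP; split.
have -> : [set w | reach_time tau n w <= t] =
    reach_time tau n @^-1` `]-oo, t]%classic `&`
    [set w | forall i, i \in (finset.set0 : {set 'I_N}) -> [set: R] (tau i w)].
  by rewrite e0 setIT; apply/seteqP; split => w /=; rewrite in_itv.
rewrite (reach_time_law n finset.set0 (fun=> setT))//; last first.
  by move=> i; rewrite inE.
by rewrite e0 probability_setT mule1.
Qed.

(** Holding times are constrained only in law, so they may be negative on a null set; off that set
    the reach times increase with the level. *)
Lemma negligible_holding_time_lt0 : P.-negligible [set w | exists i, tau i w < 0].
Proof.
pose N0 k := [set w | exists2 i : 'I_N, val i = k & tau i w < 0].
apply: (@negligibleS _ _ _ P (\bigcup_k N0 k)).
  by move=> w [i iw]; exists (val i) => //; exists i.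
(* The union is indexed by natural numbers; indices from [N] on contribute the empty set. *)
apply: negligible_bigcup => k.
have [kN|Nk] := ltnP k N; last first.
  apply: (negligibleS _ (negligible_set0 P)) => w [i ik _].
  by move: (ltn_ord i); rewrite -[nat_of_ord i]/(val i) ik ltnNge Nk.
pose i := Ordinal kN.
exists (tau i @^-1` `]-oo, 0[%classic); split => //.
- by rewrite -[X in measurable X]setTI; exact: measurable_funPT.
- rewrite -[LHS]/(distribution P (tau i) `]-oo, 0[%classic);
    case: (boolP (i \in C)) => iC.
    rewrite /distribution /pushforward (_ : _ @^-1` _ = set0) ?measure0//.
    by apply/seteqP; split => w //=; rewrite in_itv /= tau0 ?ltxx.
  rewrite taue//; apply: integral0_eq => x /=; rewrite in_itv /=.
  by move=> /lt0_exponential_pdf ->.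
- move=> w [j jk jw]; rewrite /= in_itv /= (_ : i = j)//.
  by apply: val_inj; rewrite jk.
Qed.

Lemma reach_time_le w m n : (forall i, 0 <= tau i w) -> (m <= n)%N ->
  reach_time tau m w <= reach_time tau n w.
Proof.
move=> tau_ge0 mn; rewrite /reach_time [leLHS]big_mkcond [leRHS]big_mkcond /=.
apply: ler_sum => i _; case: ifP => [im|_]; first by rewrite (leq_trans im mn).
by case: ifP.
Qed.

(** A maximum exceeds [j] exactly when some admissible index does, so this needs no monotonicity of
    the reach times. *)
Lemma level_gtE j t : [set w | (j < level_at tau t w)%N] =
  \bigcup_(i in [set i : 'I_N.+1 | (j < i)%N])
    [set w | reach_time tau i w <= t].
Proof.
apply/seteqP; split => w /=.
  rewrite /level_at ltnNge => /negP h; apply: contrapT => h'; apply: h.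
  apply/bigmax_leqP => i it; rewrite leqNgt; apply/negP => ji; apply: h'.
  by exists i.
move=> [i /= ji it]; apply: (leq_trans ji); rewrite /level_at.
exact: (@leq_bigmax_cond _ (fun i : 'I_N.+1 => reach_time tau i w <= t)
  (fun i => val i)).
Qed.

Lemma measurable_reach_time_le n t :
  measurable [set w | reach_time tau n w <= t].
Proof.
rewrite (_ : [set w | _] = reach_time tau n @^-1` `]-oo, t]%classic);
  last first.
  by apply/seteqP; split => w /=; rewrite in_itv.
by rewrite -[X in measurable X]setTI; apply: measurable_reach_time.
Qed.

Lemma measurable_level_gt j t :
  measurable [set w | (j < level_at tau t w)%N].
Proof.
rewrite level_gtE; apply: fin_bigcup_measurable => // i _.
exact: measurable_reach_time_le.
Qed.

(** Off the null set of negative holding times, having reached some level above [j] entails having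
    reached [j.+1], so the union of events reduces to its first member. *)
Lemma level_gt_cdf j t : (j < N)%N ->
  P [set w | (j < level_at tau t w)%N] =
    hypoexp_law (rates mu C j.+1) `]-oo, t]%classic.
Proof.
move=> jN; rewrite -reach_time_cdf//.
have mr := measurable_reach_time_le j.+1 t; have ml := measurable_level_gt j t.
have [Z [mZ Z0 sZ]] := negligible_holding_time_lt0.
apply/eqP; rewrite eq_le; apply/andP; split.
  apply: (@le_trans _ _ (P ([set w | reach_time tau j.+1 w <= t] `|` Z))).
    apply: le_measure; rewrite ?inE//; first exact: measurableU.
    rewrite level_gtE => w [i /= ji it].
    have [wZ|wZ] := pselect (Z w); [by right|left].
    apply: le_trans it; apply: reach_time_le => // k; rewrite leNgt;
      apply/negP => kw.
    by apply: wZ; apply: sZ; exists k.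
  have PZ : (P Z <= 0)%E by rewrite Z0.
  by apply: (le_trans (measureU2 _ _ _)) => //; rewrite -[leRHS]adde0;
    exact: leeD.
apply: le_measure; rewrite ?inE// level_gtE => w /= jt.
by exists (Ordinal (jN : (j.+1 < N.+1)%N)) => /=.
Qed.

End reach.

(** * The load in terms of the mean number of transitions *)

Lemma deliveries_untilS {N : nat} (C : {set 'I_N}) (i : 'I_N) :
  deliveries_until C i.+1 = (deliveries_until C i + (i \in C))%N.
Proof.
rewrite /deliveries_until; case: (boolP (i \in C)) => iC.
  rewrite (_ : [set c in C | (c < i.+1)%N]%SET =
    i |: [set c in C | (c < i)%N]%SET).
    by rewrite cardsU1 inE ltnn andbF addnC.
  apply/setP => c; rewrite !inE ltnS leq_eqVlt -[(c == i :> nat)]/(c == i).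
  by case: eqP => [->|_]; rewrite ?iC.
rewrite addn0; congr #|pred_of_set _|; apply/setP => c;
  rewrite !inE ltnS leq_eqVlt.
by rewrite -[(c == i :> nat)]/(c == i); case: eqP => [->|_] //;
  rewrite (negPf iC).
Qed.

(** Summation by parts: level probabilities are differences of the tails [q], and the cost [c] drops
    by 1 exactly across opportunistic levels. *)
Lemma average_load_mean_transitions {R : realType} {N : nat} (mu t : R)
    (C : {set 'I_N}) {d : measure_display} {T : measurableType d}
    (P : probability T R) (X : R -> T -> nat) :
  0 < mu -> 0 <= t -> strategy C -> level_process mu C P X ->
  average_load C P X t = N%:R - mean_transitions t (rates mu C N).
Proof.
move=> mu0 t0 hC [tau [indep tau0 taue XE]].
have /existsP[c0 /andP[c0C /eqP c00]] := hC.
pose A j := [set w | (j < level_at tau t w)%N].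
have mA j : measurable (A j) by exact: measurable_level_gt.
pose q j := fine (P (A j)).
have qS j : (j < N)%N -> q j = hypoexp_cdf t (rates mu C j.+1).
  by move=> jN; rewrite /q /A (level_gt_cdf _ mu0 _ hC _ _ indep tau0 taue).
(* Level 0 belongs to [C] and has holding time 0, so level 1 is reached at time 0. *)
have q0 : q 0 = 1.
  rewrite /q (_ : A 0 = setT) ?probability_setT//.
  rewrite /A level_gtE; apply/seteqP; split => // w _.
  have N1 : (1 < N.+1)%N by rewrite ltnS (leq_ltn_trans (leq0n _) (ltn_ord c0)).
  exists (Ordinal N1) => //=.
  have -> : 1%N = (c0 : nat).+1 by rewrite -[nat_of_ord _]/(val c0) c00.
  rewrite reach_timeS tau0// addr0 /reach_time big1// => j.
  by rewrite -[nat_of_ord c0]/(val c0) c00.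
have qN : q N = 0.
  rewrite /q (_ : A N = set0) ?measure0//; apply/seteqP; split => // w.
  rewrite /A level_gtE => -[i /= Ni _].
  by move: (ltn_ord i); rewrite ltnS leqNgt Ni.
have level_probE i : level_prob P X i.+1 t = q i - q i.+1.
  rewrite /level_prob /q -fineB ?fin_num_measure//; congr fine.
  rewrite (_ : [set w | X t w = i.+1] = A i `\` A i.+1).
    rewrite measureD ?ltey_eq ?fin_num_measure//.
    congr (_ - P _)%E; apply/seteqP; split => w; first by case.
    by rewrite /A /= => h; split => //; exact: ltnW.
  apply/seteqP; split => w; rewrite /A /= XE//.
    by move=> ->; split => //; rewrite ltnn.
  by move=> [iX /negP]; rewrite -leqNgt => Xi; apply/eqP; rewrite eqn_leq Xi.
pose c i : R := (deliveries_until C i + deadline_deliveries N i)%:R.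
have c0N : c 0 = N%:R.
  rewrite /c /deliveries_until /deadline_deliveries subn0.
  by rewrite (_ : [set _ in _ | _]%SET = finset.set0) ?cards0//;
    apply/setP => j; rewrite !inE andbF.
(* Passing level [k] saves one delivery at the deadline, and costs one injection if [k] is in
   [C]. *)
have cS k : (k < N)%N -> c k = c k.+1 + (opportunistic C k)%:R.
  move=> kN; pose i := Ordinal kN.
  rewrite /c -natrD (deliveries_untilS C i) -[k in opportunistic C k]/(i : nat).
  rewrite opportunisticE /deadline_deliveries /=.
  by congr (_%:R); rewrite -[(N - k)%N]prednK ?subn_gt0// subnS;
    case: (i \in C) => /=; lia.
(* The boundary term [c k * q k] disappears at [k = N], where [q N = 0]. *)
have sumE k : (k <= N)%N ->
    \sum_(0 <= i < k) c i.+1 * (q i - q i.+1) =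
      N%:R - c k * q k - mean_transitions t (rates mu C k).
  elim: k => [_|k IH kN].
    by rewrite big_geq// /mean_transitions big_ord0 q0 c0N mulr1 subrr subr0.
  rewrite big_nat_recr//= IH; last exact: ltnW.
  have -> : mean_transitions t (rates mu C k.+1) =
    mean_transitions t (rates mu C k) + (opportunistic C k)%:R * q k.
    rewrite qS// ratesS; case: ifP => _;
      first by rewrite mean_transitions_rcons mul1r.
    by rewrite mul0r addr0.
  by rewrite (cS k kN); ring.
rewrite /average_load big_add1 /=.
under eq_bigr do rewrite level_probE.
by rewrite sumE// qN mulr0 subr0.
Qed.

(** * Exchanging or removing levels of an optimal strategy *)

Lemma rates_split {R : realType} {N : nat} (mu : R) (C : {set 'I_N}) a :
  (a.+1 < N)%N ->
  rates mu C N = rates mu C a ++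
    [seq transition_rate N mu j | j <- [:: a; a.+1] & opportunistic C j] ++
    [seq transition_rate N mu j
      | j <- iota a.+2 (N - a.+2) & opportunistic C j].
Proof.
move=> aN; rewrite /rates [in iota 0 N](_ : N = (a + (2 + (N - a.+2)))%N);
  last by lia.
by rewrite iotaD filter_cat map_cat iotaD filter_cat map_cat add0n addn2.
Qed.

Lemma rates_gt0 {R : realType} {N : nat} (mu : R) (C : {set 'I_N}) :
  0 < mu -> strategy C ->
  all (> 0) (rates mu C N).
Proof.
move=> mu0 hC; apply/allP => r /mapP[j];
  rewrite mem_filter mem_iota /= => /andP[hj jN] ->.
by apply: (strategy_rate_gt0 mu mu0 C hC (Ordinal jN)); rewrite -opportunisticE.
Qed.

Lemma eq_rates {R : realType} {N : nat} (mu : R) (C C' : {set 'I_N}) s :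
  {in s, opportunistic C =1 opportunistic C'} ->
  [seq transition_rate N mu j | j <- s & opportunistic C j] =
    [seq transition_rate N mu j | j <- s & opportunistic C' j].
Proof. by move=> /eq_in_filter ->. Qed.

(** The rate is concave in the level: once it fails to increase, it never increases again. *)
Lemma transition_rate_decreasing {R : realType} {N : nat} (mu : R) a s :
  0 < mu ->
  transition_rate N mu a.+1 <= transition_rate N mu a -> path ltn a.+1 s ->
    all (fun j => j < N)%N s ->
  path >=%R (transition_rate N mu a.+1) [seq transition_rate N mu j | j <- s].
Proof.
move=> mu0; rewrite /transition_rate ler_pM2r// ler_nat => ab.
suff gen j : (a < j)%N -> path ltn j s -> all (fun j => j < N)%N s ->
    path >=%R ((j * (N - j))%:R * mu) [seq (j * (N - j))%:R * mu | j <- s].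
  exact: gen.
elim: s j => //= k s IH j aj /andP[jk ks] /andP[kN sN].
rewrite IH ?(ltn_trans aj)// andbT ler_pM2r// ler_nat.
(* The hypothesis at [a] forces [N <= 2a + 1], hence [N <= j + k] for [a < j < k], which gives
   [k (N - k) <= j (N - j)]. *)
nia.
Qed.

Lemma optimal_opportunistic_succ {R : realType} {N : nat} (mu t : R)
    (C : {set 'I_N}) a :
  0 < mu -> 0 < t -> strategy C ->
  (forall C' : {set 'I_N}, strategy C' ->
    mean_transitions t (rates mu C' N) <= mean_transitions t (rates mu C N)) ->
  opportunistic C a -> (a.+1 < N)%N -> opportunistic C a.+1.
Proof.
move=> mu0 t0 hC opt ha bN; apply: contraT => hb.
pose oa := Ordinal (ltnW bN); pose ob := Ordinal bN.
have hoa : oa \notin C by rewrite -opportunisticE.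
have hob : ob \in C by rewrite -[_ \in _]negbK -opportunisticE.
have [c0 c0C c00] : exists2 c, c \in C & val c = 0%N.
  by have /existsP[c /andP[? /eqP ?]] := hC; exists c.
(* The level removed from [C] is [a.+1], which is not 0, so both modifications below are still
   strategies. *)
have c0b : c0 != ob by rewrite -val_eqE /= -[nat_of_ord c0]/(val c0) c00.
have away (C' : {set 'I_N}) :
    (forall c, c != oa -> c != ob -> (c \in C') = (c \in C)) ->
    forall j, (j < N)%N -> j != a -> j != a.+1 ->
      opportunistic C j = opportunistic C' j.
  move=> CC' j jN ja jb; rewrite -[j]/(nat_of_ord (Ordinal jN)).
  by rewrite !opportunisticE CC'.
have ratesE (C' : {set 'I_N}) :
    (forall c, c != oa -> c != ob -> (c \in C') = (c \in C)) ->
    rates mu C' N = rates mu C a ++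
    [seq transition_rate N mu j | j <- [:: a; a.+1] & opportunistic C' j] ++
    [seq transition_rate N mu j
      | j <- iota a.+2 (N - a.+2) & opportunistic C j].
  move=> /away CC'; rewrite (rates_split mu C' a)//.
  have -> : rates mu C a = rates mu C' a.
    apply: eq_rates => j; rewrite mem_iota /= => ja.
    have jb := ltnW ja; apply: CC'; rewrite ?ltn_eqF//.
    exact: ltn_trans ja (ltnW bN).
  congr (_ ++ (_ ++ _)); apply: esym; apply: eq_rates => j;
    rewrite mem_iota subnKC// => /andP[aj jN].
  by apply: CC' => //; rewrite gtn_eqF// ltnW.
have eC := ratesE C (fun _ _ _ => erefl); rewrite /= ha (negPf hb) /= in eC.
have pos := rates_gt0 mu C mu0 hC; rewrite eC in pos.
have [ab|ba] := ltP (transition_rate N mu a) (transition_rate N mu a.+1).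
  (* Exchange: the rate of [a] is replaced by the larger rate of [a.+1] at the same position of the
     list. *)
  pose C' := oa |: (C :\ ob).
  have hC' : strategy C'.
    apply/existsP; exists c0; rewrite !inE c0C c0b orbT /=; exact/eqP.
  have eC' := ratesE C' _; rewrite /= in eC'.
  have := opt _ hC'; rewrite leNgt => /negP h; exfalso; apply: h.
  rewrite eC eC'; last by move=> c ca cb; rewrite !inE (negPf ca) cb.
  have -> : opportunistic C' a = false.
    by rewrite -[a]/(nat_of_ord oa) opportunisticE !inE eqxx.
  have -> : opportunistic C' a.+1.
    rewrite -[a.+1]/(nat_of_ord ob) opportunisticE !inE eqxx orbF.
    by rewrite -val_eqE /= gtn_eqF.
  by apply: mean_transitions_replace.
(* Removal: the rate of [a.+1] is inserted just after that of [a], before a tail that it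
   dominates. *)
pose C' := C :\ ob.
have hC' : strategy C'.
  apply/existsP; exists c0; rewrite !inE c0C c0b /=; exact/eqP.
have eC' := ratesE C' _; rewrite /= in eC'.
have := opt _ hC'; rewrite leNgt => /negP h; exfalso; apply: h.
have pos' := rates_gt0 mu C' mu0 hC'.
move: pos'; rewrite eC eC'; last by move=> c ca cb; rewrite !inE cb.
have -> : opportunistic C' a.
  by rewrite -[a]/(nat_of_ord oa) opportunisticE !inE negb_and hoa orbT.
have -> : opportunistic C' a.+1.
  by rewrite -[a.+1]/(nat_of_ord ob) opportunisticE !inE eqxx.
move=> /= pos'; apply: mean_transitions_insert => //.
apply: transition_rate_decreasing => //.
  rewrite path_sortedE; last exact: ltn_trans.
  rewrite sorted_filter ?iota_ltn_sorted//; last exact: ltn_trans.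
  by rewrite andbT; apply/allP => j;
    rewrite mem_filter mem_iota => /andP[_ /andP[]].
by apply/allP => j; rewrite mem_filter mem_iota subnKC// => /and3P[].
Qed.

Theorem theorem2 (R : realType) (N : nat) (mu_beta Tc : R)
    (hN : (2 <= N)%N) (hmu : 0 < mu_beta) (hTc : 0 < Tc)
    (disp : {set 'I_N} -> measure_display)
    (Omega : forall C : {set 'I_N}, measurableType (disp C))
    (P : forall C : {set 'I_N}, probability (Omega C) R)
    (X : forall C : {set 'I_N}, R -> Omega C -> nat)
    (hX : forall C : {set 'I_N}, strategy C -> level_process mu_beta C (P C) (X C))
    (C : {set 'I_N}) (hC : strategy C)
    (hmin : forall C' : {set 'I_N}, strategy C' ->
       average_load C (P C) (X C) Tc <= average_load C' (P C') (X C') Tc) :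
  exists d : nat, (1 <= d <= N)%N /\ C = [set c : 'I_N | (c < d)%N]%SET.
Proof.
have loadE (C' : {set 'I_N}) (hC' : strategy C') :
    average_load C' (P C') (X C') Tc =
      N%:R - mean_transitions Tc (rates mu_beta C' N).
  by apply: average_load_mean_transitions => //; [exact: ltW|exact: hX].
have opt (C' : {set 'I_N}) : strategy C' ->
    mean_transitions Tc (rates mu_beta C' N) <=
      mean_transitions Tc (rates mu_beta C N).
  by move=> hC'; have := hmin _ hC'; rewrite !loadE// lerD2l lerN2.
have up a : opportunistic C a -> (a.+1 < N)%N -> opportunistic C a.+1.
  exact: (@optimal_opportunistic_succ _ _ mu_beta Tc).
have hN' : opportunistic C N.
  apply/mapP => -[i _ iN].
  by move: (ltn_ord i); rewrite -[nat_of_ord i]/(val i) -iN ltnn.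
(* [d] is the least level outside [C]; counting [N] as opportunistic guarantees that it exists, with
   [d = N] when [C] contains every level. *)
have [d hd dmin] := ex_minnP (ex_intro (fun n => opportunistic C n) N hN').
have dN := dmin _ hN'.
exists d; split.
  rewrite dN andbT lt0n; apply/eqP => d0;
    have /existsP[c /andP[cC /eqP c0]] := hC.
  by move: hd; rewrite d0 -c0 -[val c]/(nat_of_ord c) opportunisticE cC.
apply/setP => c; rewrite inE; have [cd|dc] := ltnP c d.
  by apply/negPn; rewrite -opportunisticE; apply/negP => /dmin;
    rewrite leqNgt cd.
apply/negbTE; rewrite -opportunisticE.
(* Optimality propagates being outside [C] from [d] to every later level below [N]. *)
have step k : (d + k < N)%N -> opportunistic C (d + k).
  elim: k => [|k IH]; first by rewrite addn0.
  by rewrite addnS => dkN; apply: up => //; apply: IH; exact: ltnW.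
by rewrite -(subnKC dc); apply: step; rewrite subnKC.
Qed.
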